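(* Let $(X,m)$ be a $\sigma$-finite measure space, let $p\in[1,\infty)$, and let $L$ be the infinitesimal generator of a strongly continuous, sub-Markovian semigroup $S=(S(t))_{t\ge 0}$ of bounded linear operators on $L^p(X,m)$. Let $f:[0,\infty)\to[0,\infty)$ be convex and continuous on $[0,\infty)$ with $f(0)=0$, $f(s)>0$ for all $s>0$, and $\int_1^\infty \frac{1}{f(s)}\,ds<\infty$. Let $F:(0,\infty)\to(0,\infty)$, $F(t)=\int_t^\infty \frac{1}{f(s)}\,ds$, which is a bijection with inverse $F^{-1}$. Let $a\in L^p(X,m)$ be nonnegative. Assume that there exist a time $T>0$ and a measurable subset $G$ of $X$ with $m(G)\in(0,\infty)$ such that $$\frac{1}{m(G)}\int_G S(T)a\,dm > F^{-1}(T).$$ Then the initial value problem $u'=Lu+f(u)$, $u(0)=a$, $u\ge 0$, has no global mild solution. More precisely, $T$ is an upper bound on the existence time of a mild solution: if $u$ is a mild solution in an interval $I\subseteq[0,\infty)$ with $0\in I$, then $\sup I\le T$.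
   Context: $L^p(X,m)$ is the space of (equivalence classes of) real-valued $p$-integrable functions, and $L^p_+(X,m)$ is its subset of functions that are nonnegative $m$-almost everywhere. The semigroup $S$ is sub-Markovian if for every $t>0$ and every $\phi\in L^p(X,m)$ taking values in $[0,1]$ $m$-a.e., $S(t)\phi$ also takes values in $[0,1]$ $m$-a.e. The symbol $f$ also denotes the composition operator $f(\phi):=f\circ\phi$ with domain $D(f):=\{\phi\in L^p_+(X,m): f\circ\phi\in L^p(X,m)\}$. Let $I$ be an interval of nonnegative real numbers with $0\in I$. A function $u:I\to L^p_+(X,m)$ is a mild solution in $I$ of the initial value problem $u'=Lu+f(u)$, $u(0)=a$, $u\ge 0$, if $u(t)\in D(f)$ for all $t\in I\setminus\{0\}$, $f\circ u\in L^1((0,t];L^p(X,m))$ (Bochner integrable) for every $t\in I\setminus\{0\}$, and $$u(t)=S(t)a+\int_0^t S(t-s)f(u(s))\,ds\quad\text{for every }t\in I,$$ where the integral is a Bochner integral. If $I=[0,\infty)$, then $u$ is called a global mild solution. *)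

(* Defs.v *)
From HB Require Import structures.
From mathcomp Require Import all_boot all_order all_algebra.
From mathcomp Require Import all_classical all_reals all_analysis.
From mathcomp Require Import measurable_realfun ess_sup_inf.

Set Implicit Arguments.
Unset Strict Implicit.
Unset Printing Implicit Defensive.

Import Order.TTheory GRing.Theory Num.Def Num.Theory.
Import numFieldNormedType.Exports.

Local Open Scope classical_set_scope.
Local Open Scope ring_scope.
Local Open Scope quotient_scope.

Section lspace_class.
Context d (T : measurableType d) (R : realType).
Variables (mu : {measure set T -> \bar R}) (p : \bar R) (p1 : (1 <= p)%E).
Local Notation Lp := (LspaceType mu p1).
Local Notation Lf := (LfunType mu p1).

Lemma ae_eq_Lnorm (f g : T -> R) :
  measurable_fun [set: T] f -> measurable_fun [set: T] g ->
  f = g %[ae mu] -> ('N[mu]_p[EFin \o f] = 'N[mu]_p[EFin \o g])%E.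
Proof.
move=> mf mg fg; rewrite unlock /Lnorm.
have fgE : \forall x \ae mu, (EFin \o f) x = (EFin \o g) x.
  by apply: filterS fg => x /(_ I)/= ->.
case: p p1 => [r _|_|//].
- have mr (h : T -> R) : measurable_fun [set: T] h ->
      measurable_fun [set: T] (fun x => (`|(EFin \o h) x| `^ r)%E).
    move=> mh; apply: (measurableT_comp (measurable_poweR _)).
    by apply: measurableT_comp => //; exact/measurable_EFinP.
  congr (_ `^ _)%E; apply: ae_eq_integral => //; [exact: mr|exact: mr|].
  by apply: filterS fgE => x /= [->].
- case: ifPn => // _; apply: eq_ess_sup.
  by apply: filterS fgE => x /= [->].
Qed.

Definition mfunR (f : T -> R) (mf : measurable_fun [set: T] f) :
    {mfun T >-> measurableTypeR R} :=
  HB.pack f (@isMeasurableFun.Build _ _ T (measurableTypeR R) f mf).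

Lemma mfunR_measurable (f : {mfun T >-> measurableTypeR R}) :
  measurable_fun [set: T] (f : T -> R).
Proof. exact: (@measurable_funPT _ _ T (measurableTypeR R) f). Qed.

Let pir (f : {mfun T >-> measurableTypeR R}) :
  {mfun_ mu, T >-> measurableTypeR R} := \pi f.

Let pir_ae f : (pir f : T -> R) = f %[ae mu].
Proof.
have /eqmodP/asboolP := reprK (pir f).
by [].
Qed.

Lemma Lspace_measurable (u : Lp) : measurable_fun [set: T] (u : T -> R).
Proof. exact: mfunR_measurable. Qed.

Let Lclass_finite (f : Lf) :
  finite_norm mu p (pir (mfunR (measurable_funPT f)) : T -> R).
Proof.
rewrite /finite_norm (@ae_eq_Lnorm _ f).
- exact: Lfunction_finite.
- exact: mfunR_measurable.
- exact: measurable_funPT.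
- exact: pir_ae.
Qed.

Definition Lclass (f : Lf) : Lp :=
  HB.pack (pir (mfunR (measurable_funPT f)))
    (@isFinLebesgue.Build d T R mu p p1 _ (Lclass_finite f)).

Let Lrepr_Lfun (u : Lp) : (u : T -> R) \in Lfun mu p.
Proof.
rewrite inE; apply/andP; split; rewrite inE; first exact: Lspace_measurable.
exact: Lebesgue_finite.
Qed.

Definition Lrepr (u : Lp) : Lf := Lfun_Sub p1 (Lrepr_Lfun u).

Lemma LreprE (u : Lp) : (Lrepr u : T -> R) = u.
Proof. by []. Qed.

Lemma Lclass_ae (f : Lf) : (Lclass f : T -> R) = f %[ae mu].
Proof. exact: pir_ae. Qed.

Lemma Lspace_eqP (u v : Lp) : (u : T -> R) = v %[ae mu] <-> u = v.
Proof.
split=> [uv|->]; last exact: ae_eq_refl.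
have E : (u : {mfun_ mu, T >-> measurableTypeR R}) = v.
  rewrite -[LHS]reprK -[RHS]reprK; apply/eqmodP/asboolP.
  exact: uv.
case: u v uv E => [u [[cu]]] [v [[cv]]] /= _ E.
subst v.
by congr LebesgueSpace.Pack; congr LebesgueSpace.Class; congr isFinLebesgue.Axioms_; exact: Prop_irrelevance.
Qed.

End lspace_class.

Section lspace_lmodule.
Context d (T : measurableType d) (R : realType).
Variables (mu : {measure set T -> \bar R}) (p : \bar R) (p1 : (1 <= p)%E).
Local Notation Lp := (LspaceType mu p1).
Local Notation Lf := (LfunType mu p1).

HB.instance Definition _ := gen_eqMixin Lp.
HB.instance Definition _ := gen_choiceMixin Lp.

Let add (u v : Lp) : Lp := Lclass (Lrepr u + Lrepr v).
Let opp (u : Lp) : Lp := Lclass (- Lrepr u).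
Let zero : Lp := Lclass 0.
Let scale (a : R) (u : Lp) : Lp := Lclass (a *: Lrepr u).

Let addE u v : (add u v : T -> R) = (fun x => u x + v x) %[ae mu].
Proof. exact: Lclass_ae. Qed.

Let oppE u : (opp u : T -> R) = (fun x => - u x) %[ae mu].
Proof. exact: Lclass_ae. Qed.

Let zeroE : (zero : T -> R) = (fun=> 0) %[ae mu].
Proof. exact: Lclass_ae. Qed.

Let scaleE a u : (scale a u : T -> R) = (fun x => a * u x) %[ae mu].
Proof. exact: Lclass_ae. Qed.

Let addA : associative add.
Proof.
move=> u v w; apply/Lspace_eqP.
apply: filterS3 (addE u (add v w)) (addE (add u v) w)
  (filterI (addE u v) (addE v w)).
by move=> x /(_ I) h3 /(_ I) h4 [/(_ I) h1 /(_ I) h2] _; rewrite h3 h2 h4 h1 addrA.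
Qed.

Let addC : commutative add.
Proof.
move=> u v; apply/Lspace_eqP.
apply: filterS2 (addE u v) (addE v u) => x /(_ I) h1 /(_ I) h2 _.
by rewrite h1 h2 addrC.
Qed.

Let add0 : left_id zero add.
Proof.
move=> u; apply/Lspace_eqP.
apply: filterS2 (addE zero u) zeroE => x /(_ I) h1 /(_ I) h2 _.
by rewrite h1 h2 add0r.
Qed.

Let addN : left_inverse zero opp add.
Proof.
move=> u; apply/Lspace_eqP.
apply: filterS3 (addE (opp u) u) zeroE (oppE u).
by move=> x /(_ I) h1 /(_ I) h2 /(_ I) h3 _; rewrite h1 h2 h3 addNr.
Qed.

HB.instance Definition _ := GRing.isZmodule.Build Lp addA addC add0 addN.

Let scaleA a b u : scale a (scale b u) = scale (a * b) u.
Proof.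
apply/Lspace_eqP.
apply: filterS3 (scaleE a (scale b u)) (scaleE b u) (scaleE (a * b) u).
by move=> x /(_ I) h1 /(_ I) h2 /(_ I) h3 _; rewrite h1 h2 h3 mulrA.
Qed.

Let scale1 : left_id 1 scale.
Proof.
move=> u; apply/Lspace_eqP.
by apply: filterS (scaleE 1 u) => x /(_ I) h1 _; rewrite h1 mul1r.
Qed.

Let scaleDr : right_distributive scale +%R.
Proof.
move=> a u v; apply/Lspace_eqP.
apply: filterS3 (addE (scale a u) (scale a v))
  (filterI (scaleE a u) (scaleE a v))
  (filterI (scaleE a (u + v)) (addE u v)).
move=> x /(_ I) h1 [/(_ I) h2 /(_ I) h3] [/(_ I) h4 /(_ I) h5] _.
by rewrite h4 h5 mulrDr h1 h2 h3.
Qed.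

Let scaleDl u : {morph scale^~ u : a b / a + b}.
Proof.
move=> a b; apply/Lspace_eqP.
apply: filterS3 (addE (scale a u) (scale b u))
  (filterI (scaleE a u) (scaleE b u)) (scaleE (a + b) u).
move=> x /(_ I) h1 [/(_ I) h2 /(_ I) h3] /(_ I) h4 _.
by rewrite h4 mulrDl h1 h2 h3.
Qed.

HB.instance Definition _ :=
  GRing.Zmodule_isLmodule.Build R Lp scaleA scale1 scaleDr scaleDl.

Lemma LspaceD (u v : Lp) :
  ((u + v : Lp) : T -> R) = (fun x => u x + v x) %[ae mu].
Proof. exact: addE. Qed.

Lemma LspaceN (u : Lp) :
  ((- u : Lp) : T -> R) = (fun x => - u x) %[ae mu].
Proof. exact: oppE. Qed.

Lemma Lspace0 : ((0 : Lp) : T -> R) = (fun=> 0) %[ae mu].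
Proof. exact: zeroE. Qed.

Lemma LspaceZ a (u : Lp) :
  ((a *: u : Lp) : T -> R) = (fun x => a * u x) %[ae mu].
Proof. exact: scaleE. Qed.

Let nm (u : Lp) : R := fine ('N[mu]_p[EFin \o (u : T -> R)])%E.

Let nm_class (f : Lf) : nm (Lclass f) = fine ('N[mu]_p[EFin \o f])%E.
Proof.
rewrite /nm; congr fine; apply: (ae_eq_Lnorm p1 (Lspace_measurable _)) => //.
exact: Lclass_ae.
Qed.

Let nmD u v : nm (u + v) <= nm u + nm v.
Proof. by rewrite nm_class; exact: ler_LnormD. Qed.

Let nmZ a u : nm (a *: u) = `|a| * nm u.
Proof.
rewrite nm_class; apply/EFin_inj; rewrite finite_norm_fine.
rewrite (_ : EFin \o _ = EFin \o (a \*: Lrepr u)) // LnormZ EFinM.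
by rewrite -finite_norm_fine.
Qed.

Let nm0_eq0 u : nm u = 0 -> u = 0.
Proof.
move=> /(@fine_Lnormr_eq0 _ _ _ mu p p1 (Lrepr u)) u0; apply/Lspace_eqP.
by apply: filterS2 u0 Lspace0 => x /(_ I) h1 /(_ I) h2 _; rewrite h2; exact: h1.
Qed.

HB.instance Definition _ := @Lmodule_isNormed.Build R Lp nm nmD nmZ nm0_eq0.

Lemma Lspace_normE (u : Lp) : `|u| = fine ('N[mu]_p[EFin \o (u : T -> R)])%E.
Proof. by []. Qed.

End lspace_lmodule.

Section bochner.
Context d (T : measurableType d) (R : realType) (E : normedModType R).
Variables (mu : {measure set T -> \bar R}) (D : set T).
Implicit Types (s g : T -> E) (sn : nat -> T -> E).

Definition simple_fun s : Prop :=
  [/\ finite_set (s @` D),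
      forall y, measurable (D `&` s @^-1` [set y]) &
      forall y, y != 0 -> (mu (D `&` s @^-1` [set y]) < +oo)%E].

(* [fine] sends the possibly infinite measure of the zero set of [s] to a
   real, which is then multiplied by [y = 0]. *)
Definition simple_integral s : E :=
  \sum_(y \in s @` D) fine (mu (D `&` s @^-1` [set y])) *: y.

(* The pointwise condition makes [g] strongly measurable up to a null set. On
   an integrand that is measurable only up to a null set, [\int] is the
   supremum over the simple functions below it, so it ignores that null set. *)
Definition bochner_approx sn g : Prop :=
  [/\ forall n, simple_fun (sn n),
      {ae mu, forall x, D x -> sn n x @[n --> \oo] --> g x} &
      (\int[mu]_(x in D) `|sn n x - g x|%:E)%E @[n --> \oo] --> 0%E].

Definition bochner_integrable g : Prop := exists sn, bochner_approx sn g.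

(* [E] is not assumed complete here; when it is, every integrable function has
   an integral. *)
Definition has_bochner_integral g (v : E) : Prop :=
  exists2 sn, bochner_approx sn g & simple_integral (sn n) @[n --> \oo] --> v.

End bochner.

Section semigroup.
Context (R : realType) (E : normedModType R).
Implicit Types S : R -> {linear E -> E}.

(* [S t] is only meaningful for [0 <= t]. *)
Record c0_semigroup S : Prop := C0Semigroup {
  c0_bounded : forall t, 0 <= t ->
    exists M : R, forall x, `|S t x| <= M * `|x| ;
  c0_id : forall x, S 0 x = x ;
  c0_add : forall s t x, 0 <= s -> 0 <= t -> S (s + t) x = S s (S t x) ;
  c0_continuous : forall x, {within `[0, +oo[, continuous (fun t => S t x)} }.

(* The generator is an unbounded operator: a domain [DL] and a function [L]
   that is only meaningful on [DL]. *)
Definition infinitesimal_generator S (DL : set E) (L : E -> E) : Prop :=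
  DL = [set x | cvg (h^-1 *: (S h x - x) @[h --> 0^'+])] /\
  forall x, DL x -> h^-1 *: (S h x - x) @[h --> 0^'+] --> L x.

End semigroup.

Section semilinear.
Context d (X : measurableType d) (R : realType).
Variables (m : {measure set X -> \bar R}) (p : \bar R) (p1 : (1 <= p)%E).
Local Notation Lp := (LspaceType m p1).

Definition sub_markovian (S : R -> {linear Lp -> Lp}) : Prop :=
  forall t (phi : Lp), 0 < t ->
    {ae m, forall x, 0 <= phi x <= 1} -> {ae m, forall x, 0 <= S t phi x <= 1}.

Definition ae_nonneg (phi : Lp) : Prop := {ae m, forall x, 0 <= phi x}.

(* A representative of a class that is nonnegative a.e. may take negative
   values, where [f] is unconstrained; hence the a.e. equalities, which do not
   require [f \o phi] itself to be measurable. *)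
Definition comp_dom (f : R -> R) : set Lp :=
  [set phi | ae_nonneg phi /\
             exists psi : Lp, (psi : X -> R) = f \o phi %[ae m]].

Definition comp_op (f : R -> R) (phi : Lp) : Lp :=
  xget 0 [set psi : Lp | (psi : X -> R) = f \o phi %[ae m]].

Lemma comp_opE f phi : comp_dom f phi ->
  (comp_op f phi : X -> R) = f \o phi %[ae m].
Proof.
by move=> [_ [psi h]]; exact: (@xgetPex _ 0 [set psi : Lp | _] (ex_intro _ psi h)).
Qed.

(* [u] is only meaningful on the interval [I]. *)
Record mild_solution (S : R -> {linear Lp -> Lp}) (f : R -> R) (a : Lp)
    (I : set R) (u : R -> Lp) : Prop := MildSolution {
  mild_ge0 : forall t, I t -> ae_nonneg (u t) ;
  mild_dom : forall t, I t -> t != 0 -> comp_dom f (u t) ;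
  mild_integrable : forall t, I t -> t != 0 ->
    bochner_integrable lebesgue_measure `]0, t] (fun s => comp_op f (u s)) ;
  mild_eq : forall t, I t -> exists2 v,
    has_bochner_integral lebesgue_measure `]0, t]
      (fun s => S (t - s) (comp_op f (u s))) v &
    u t = S t a + v }.

Definition global_mild_solution S f a u := mild_solution S f a `[0, +oo[ u.

End semilinear.

Definition osgood (R : realType) (f : R -> R) (t : R) : R :=
  \int[lebesgue_measure]_(s in `[t, +oo[) (f s)^-1.

(* [pinv] is the inverse on the image of [`]0, +oo[], which is [`]0, +oo[] again
   when [f] is convex, vanishes at [0], is positive on [`]0, +oo[] and has
   [1 / f] integrable at infinity. *)
Definition osgood_inv (R : realType) (f : R -> R) : R -> R :=
  'pinv_(fun=> 0) `]0, +oo[ (osgood f).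

(* Main.v *)
Require Import Defs.
From mathcomp Require Import all_boot all_order all_algebra.
From mathcomp Require Import all_classical all_reals all_analysis.
From mathcomp Require Import measurable_realfun ring lra.
Import Order.TTheory GRing.Theory Num.Def Num.Theory.
Import numFieldNormedType.Exports.

(** Suppose that a mild solution [u] exists up to time [T], and watch the
    number [y t], the mean over [G] of [S (T - t) (u t)].  The semigroup law
    gives [S (T - t) (S (t - s) w) = S (T - s) w], so the variation of constants
    formula for [u], seen through the bounded linear form
    [mean G \o S (T - t)], becomes a scalar Volterra equation whose integrand
    depends on [s] alone:
    [y t = y 0 + \int_0^t k s ds], where [k s] is the mean of
    [S (T - s) (f (u s))] and [y 0] is the mean of [S T a].

    The form [mean G \o S (T - s)] maps functions with values in [0, 1] to
    numbers in [0, 1], hence obeys Jensen's inequality for the convex function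
    [f] vanishing at [0] ([sub_markov_functional_jensen]), that is
    [k s >= f (y s)].  Thus [y' >= f (y)] in integrated form, and such a [y]
    blows up before the time [\int_(y 0)^oo 1 / f], which is [osgood f (y 0)]
    ([osgood_lifespan]).  Being finite up to time [T], it satisfies
    [T < osgood f (y 0)].  But the hypothesis says that [y 0] exceeds
    [osgood_inv f T], and [osgood f] is nonincreasing and onto [`]0, +oo[], so
    [osgood f (y 0) <= T] ([osgood_le_of_gt_inv]): a contradiction.

    The passage from the Bochner integral to the scalar integral is
    [bochner_form_integral]. *)

Set Implicit Arguments.
Unset Strict Implicit.
Unset Printing Implicit Defensive.

Local Open Scope classical_set_scope.
Local Open Scope ring_scope.

(** * Bounded linear forms *)

(** A predicate on plain functions rather than a bundled linear map: the forms
    in question, such as the mean over [G], are linear only on condition that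
    [G] has finite measure. *)
Definition bounded_form (R : realType) (E : normedModType R) (Phi : E -> R) :=
  scalar Phi /\ exists C : R, forall x, `|Phi x| <= C * `|x|.

Section bounded_form.
Context (R : realType) (E : normedModType R) (Phi : E -> R).
Hypothesis bPhi : bounded_form Phi.

Lemma bformD u v : Phi (u + v) = Phi u + Phi v.
Proof. by have := bPhi.1 1 u v; rewrite scale1r mul1r. Qed.

Lemma bform0 : Phi 0 = 0.
Proof. by apply: (addrI (Phi 0)); rewrite -bformD !addr0. Qed.

Lemma bformZ c u : Phi (c *: u) = c * Phi u.
Proof. by have := bPhi.1 c u 0; rewrite addr0 bform0 addr0. Qed.

Lemma bformN u : Phi (- u) = - Phi u.
Proof. by rewrite -scaleN1r bformZ mulN1r. Qed.

Lemma bformB u v : Phi (u - v) = Phi u - Phi v.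
Proof. by rewrite bformD bformN. Qed.

Lemma bform_bound : exists2 C : R, 0 <= C & forall x, `|Phi x| <= C * `|x|.
Proof.
have [_ [C PhiC]] := bPhi; exists `|C| => // x.
by apply: le_trans (PhiC x) _; rewrite ler_wpM2r// ler_norm.
Qed.

Lemma bform_cvg (w : nat -> E) (u : E) :
  w n @[n --> \oo] --> u -> Phi (w n) @[n --> \oo] --> Phi u.
Proof.
have [C C0 PhiC] := bform_bound => wu; apply/cvgrPdist_lt => e e0.
have C1 : 0 < C + 1 by rewrite ltr_wpDl.
have : \forall n \near \oo, `|u - w n| < e / (C + 1).
  by move/cvgrPdist_lt : wu => /(_ (e / (C + 1))); apply; rewrite divr_gt0.
apply: filterS => n; rewrite ltr_pdivlMr// => uw.
rewrite -bformB (le_lt_trans (PhiC _))// (le_lt_trans _ uw)// mulrC ler_wpM2l//.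
by rewrite lerDl.
Qed.

End bounded_form.

Lemma bounded_form_scale (R : realType) (E : normedModType R) (Phi : E -> R) (c : R) :
  bounded_form Phi -> bounded_form (fun x => c * Phi x).
Proof.
move=> bPhi; split=> [b x y|]; first by rewrite bformD// bformZ//; ring.
have [C C0 PhiC] := bform_bound bPhi; exists (`|c| * C) => x.
by rewrite normrM -mulrA ler_wpM2l.
Qed.

Lemma bounded_form_comp (R : realType) (E : normedModType R) (Phi : E -> R)
    (P : {linear E -> E}) :
  bounded_form Phi -> (exists M : R, forall x, `|P x| <= M * `|x|) ->
  bounded_form (Phi \o P).
Proof.
move=> bPhi [M PM]; split=> [b x y|]; first by rewrite /= linearP bformD// bformZ.
have [C C0 PhiC] := bform_bound bPhi; exists (C * M) => x /=.
by rewrite (le_trans (PhiC _))// -mulrA ler_wpM2l.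
Qed.

(** * Elements of the Lebesgue space as functions *)

Section Lspace.
Context d (X : measurableType d) (R : realType).
Variables (m : {measure set X -> \bar R}) (p : R) (p1 : (1 <= p%:E)%E).
Local Notation Lp := (LspaceType m p1).
Implicit Types (u v w : Lp) (G : set X).

Let p_ge1 : 1 <= p. Proof. by rewrite -lee_fin. Qed.
Let p_gt0 : 0 < p. Proof. exact: lt_le_trans p_ge1. Qed.
Let p_neq0 : p != 0. Proof. by rewrite gt_eqF. Qed.

Lemma Lspace_norm_powR u :
  ((`|u| `^ p)%:E = \int[m]_x (`|u x| `^ p)%:E)%E.
Proof.
rewrite -[RHS]/(\int[m]_x (`|(EFin \o (u : X -> R)) x| `^ p))%E -powR_Lnorm//.
by rewrite Lspace_normE -[in RHS](@fineK _ 'N[m]_p%:E[_]%E) ?poweR_EFin// fin_num_abs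
   gee0_abs ?Lnorm_ge0//; exact: Lebesgue_finite.
Qed.

Lemma Lspace_integrable_powR u :
  m.-integrable setT (fun x => (`|u x| `^ p)%:E).
Proof. by apply: Lfun_integrable => //; rewrite -(LreprE u); exact: LfunP. Qed.

Lemma measurable_Lspace G u : measurable_fun G (u : X -> R).
Proof. by apply: measurable_funTS; exact: Lspace_measurable. Qed.

(** This crude bound replaces Hoelder's inequality: it makes functions of the
    Lebesgue space integrable on sets of finite measure, and homogeneity turns
    it into continuity of the integral. *)
Lemma ler1_powR (r : R) : `|r| <= 1 + `|r| `^ p.
Proof.
have [r1|/ltW r1] := leP `|r| 1; first by rewrite (le_trans r1)// lerDl powR_ge0.
by rewrite (le_trans (_ : _ <= `|r| `^ p)) ?lerDr// -[leLHS]powRr1// ler_powR.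
Qed.

Lemma Lspace_integrable G u : measurable G -> (m G < +oo)%E ->
  m.-integrable G (EFin \o (u : X -> R)).
Proof.
move=> mG Gfin.
apply: (@le_integrable _ _ _ _ _ mG _ (fun x => 1%:E + (`|u x| `^ p)%:E)%E).
- by apply/measurable_EFinP; exact: measurable_Lspace.
- move=> x _; rewrite -EFinD lee_fin [leRHS]ger0_norm ?ler1_powR//.
- apply: integrableD => //; last exact: integrableS (Lspace_integrable_powR u).
  apply/integrableP; split=> //.
  under eq_integral do rewrite /= normr1.
  by rewrite integral_cst// mul1e.
Qed.

Lemma Rintegral_Lspace_bound G u : measurable G -> (m G < +oo)%E ->
  `|\int[m]_(x in G) u x| <= fine (m G) + `|u| `^ p.
Proof.
move=> mG Gfin; have iu := Lspace_integrable u mG Gfin.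
rewrite (le_trans (le_normr_Rintegral mG iu))// -lee_fin.
rewrite /Rintegral fineK; last first.
  by apply: integrable_fin_num => //; exact: integrable_norm.
rewrite EFinD Lspace_norm_powR fineK ?ge0_fin_numE//.
apply: (@le_trans _ _ (\int[m]_(x in G) (1 + `|u x| `^ p)%:E)%E).
  apply: ge0_le_integral => //.
  - by apply/measurable_EFinP; apply: measurableT_comp => //; exact: measurable_Lspace.
  - apply/measurable_EFinP; apply: measurable_funD => //.
    apply: (measurableT_comp (measurable_powR _)) => //.
    by apply: measurableT_comp => //; exact: measurable_Lspace.
  - by move=> x _; rewrite lee_fin ler1_powR.
have mup A : measurable_fun A (fun x => (`|u x| `^ p)%:E).
  apply/measurable_EFinP; apply: (measurableT_comp (measurable_powR _)) => //.
  by apply: measurableT_comp => //; exact: measurable_Lspace.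
under eq_integral do rewrite EFinD.
rewrite ge0_integralD//.
by rewrite integral_cst// mul1e leeD2l// ge0_subset_integral.
Qed.

Lemma Rintegral_LspaceD G u v : measurable G -> (m G < +oo)%E ->
  \int[m]_(x in G) (u + v : Lp) x = \int[m]_(x in G) u x + \int[m]_(x in G) v x.
Proof.
move=> mG Gfin; rewrite -RintegralD//; [|exact: Lspace_integrable..].
congr fine; apply: ae_eq_integral => //.
- by apply/measurable_EFinP; exact: measurable_Lspace.
- by apply/measurable_EFinP; apply: measurable_funD; exact: measurable_Lspace.
- by apply: filterS (LspaceD u v) => x /(_ I) -> _.
Qed.

Lemma Rintegral_LspaceZ G c u : measurable G -> (m G < +oo)%E ->
  \int[m]_(x in G) (c *: u : Lp) x = c * \int[m]_(x in G) u x.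
Proof.
move=> mG Gfin; rewrite -RintegralZl//; [|exact: Lspace_integrable..].
congr fine; apply: ae_eq_integral => //.
- by apply/measurable_EFinP; exact: measurable_Lspace.
- by apply/measurable_EFinP; apply: measurable_funM => //; exact: measurable_Lspace.
- by apply: filterS (LspaceZ c u) => x /(_ I) -> _.
Qed.

(** [Rintegral_Lspace_bound] is not homogeneous in [u]; apply it to [u] scaled to
    norm [1]. *)
Lemma bounded_form_Rintegral G : measurable G -> (m G < +oo)%E ->
  bounded_form (fun u : Lp => \int[m]_(x in G) u x).
Proof.
move=> mG Gfin; split=> [c u v|]; first by rewrite Rintegral_LspaceD// Rintegral_LspaceZ.
exists (fine (m G) + 1) => u.
have [->|u0] := eqVneq u 0.
  rewrite normr0 mulr0 -(scale0r (0 : Lp)) Rintegral_LspaceZ// mul0r normr0//.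
have nu : `|u| != 0 by rewrite normr_eq0.
have := Rintegral_Lspace_bound (`|u|^-1 *: u) mG Gfin.
rewrite Rintegral_LspaceZ// normrM normrZ normfV normr_id mulVf// powR1.
by rewrite ler_pdivrMl ?normr_gt0// mulrC.
Qed.

(** Makes truncations and positive parts available as elements of the space. *)
Lemma Lspace_dominated (h : X -> R) u : measurable_fun setT h ->
  (forall x, `|h x| <= `|u x|) -> exists w : Lp, (w : X -> R) = h %[ae m].
Proof.
move=> mh hu.
have hL : h \in Lfun m p%:E.
  apply/andP; split; rewrite inE//=.
  rewrite /finite_norm unlock; apply: poweR_lty.
  have /integrableP[_] := Lspace_integrable_powR u; apply: le_lt_trans.
  apply: ge0_le_integral => //.
  - by move=> x _; exact: poweR_ge0.
  - apply/measurable_EFinP; apply: (measurableT_comp (measurable_powR _)) => //.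
    exact: measurableT_comp.
  - apply: measurableT_comp => //.
    apply/measurable_EFinP; apply: (measurableT_comp (measurable_powR _)) => //.
    by apply: measurableT_comp => //; exact: measurable_Lspace.
  - move=> x _; rewrite [leRHS]gee0_abs ?lee_fin ?powR_ge0//=.
    by apply: ge0_ler_powR; rewrite ?nnegrE// ltW.
by exists (Lclass (Lfun_Sub p1 hL)); exact: Lclass_ae.
Qed.

(** By dominated convergence, with [`|u| `^ p] as the dominating function. It
    extends properties of bounded functions to the whole space. *)
Lemma Lspace_truncation u : exists2 w : nat -> Lp,
  forall n, (w n : X -> R) = (fun x => minr (u x) n%:R) %[ae m] &
  w n @[n --> \oo] --> u.
Proof.
have mmin n : measurable_fun setT (fun x => minr (u x) n%:R).
  by apply: measurable_minr => //; exact: measurable_Lspace.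
have /(_ _)/cid-/all_sig[w wE] n :
    exists w : Lp, (w : X -> R) = (fun x => minr (u x) n%:R) %[ae m].
  apply: (@Lspace_dominated _ u) => // x.
  have [//|/ltW nu] := leP (u x) n%:R.
  by rewrite !ger0_norm// (le_trans _ nu).
exists w => //.
pose dn n x := (`|u x - minr (u x) n%:R| `^ p)%:E.
have mdn n : measurable_fun setT (dn n).
  apply/measurable_EFinP; apply: (measurableT_comp (measurable_powR _)) => //.
  apply: measurableT_comp => //; apply: measurable_funB => //.
  exact: measurable_Lspace.
have [||||_ _] := @dominated_convergence _ _ _ m setT measurableT dn (cst 0%E)
   (fun x => (`|u x| `^ p)%:E) mdn.
- exact: measurable_cst.
- apply: aeW => x _; apply: cvg_near_cst; near=> n; rewrite /dn /=.
  rewrite min_l ?subrr ?normr0 ?powR0//.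
  near: n; exists (Num.truncn `|u x|).+1 => // n /= un.
  rewrite (le_trans (ler_norm _))// ltW// (lt_le_trans (truncnS_gt _))//.
  by rewrite ler_nat.
- exact: Lspace_integrable_powR.
- apply: aeW => x n _; rewrite gee0_abs ?lee_fin ?powR_ge0//.
  apply: ge0_ler_powR; rewrite ?nnegrE//; first exact: ltW.
  have [un|/ltW nu] := leP (u x) n%:R; first by rewrite subrr normr0.
  rewrite ger0_norm ?subr_ge0//  ger0_norm; last exact: le_trans nu.
  by rewrite lerBlDr lerDl.
rewrite integral0 => dn0.
have wn n : (\int[m]_x dn n x)%E = (`|u - w n| `^ p)%:E.
  rewrite Lspace_norm_powR; apply: ae_eq_integral => //.
    apply/measurable_EFinP; apply: (measurableT_comp (measurable_powR _)) => //.
    by apply: measurableT_comp => //; exact: measurable_Lspace.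
  apply: filterS3 (wE n) (LspaceD u (- w n)) (LspaceN (w n)).
  by move=> x /(_ I) h1 /(_ I) h2 /(_ I) h3 _; rewrite /dn h2 h3 h1.
apply/cvgrPdist_lt => e e0.
have : \forall n \near \oo, (\int[m]_x dn n x < (e `^ p)%:E)%E.
  move/fine_cvgP : dn0 => [_ /cvgrPdist_lt/(_ _ (powR_gt0 p e0))].
  apply: filterS => n /=; rewrite wn/= sub0r normrN ger0_norm ?powR_ge0//.
apply: filterS => n; rewrite wn lte_fin; apply: contraTT; rewrite -!leNgt => en.
by apply: ge0_ler_powR; rewrite ?nnegrE// ltW.
Unshelve. all: by end_near. Qed.

End Lspace.

(** * Supporting lines of convex functions *)

Section convex.
Context (R : realType) (f : R -> R).
Hypothesis f_convex : convex_function (`[0, +oo[%classic : set R) f.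

Lemma convex_three_points (x y z : R) : 0 <= x -> x < y -> y < z ->
  (z - x) * f y <= (z - y) * f x + (y - x) * f z.
Proof.
move=> x0 xy yz; have xz := lt_trans xy yz.
have zx0 : 0 < z - x by rewrite subr_gt0.
have t0 : 0 <= (z - y) / (z - x) by rewrite divr_ge0 ?subr_ge0 ?ltW.
have t1 : (z - y) / (z - x) <= 1.
  by rewrite ler_pdivrMr// mul1r lerD2l lerN2 ltW.
have := @f_convex (Itv01 t0 t1) x z.
rewrite !inE/= !in_itv/= !andbT => /(_ x0 (le_trans x0 (ltW xz))).
rewrite !convRE/= /unstable.onem.
set c := (X in f X <= _); have -> : c = y.
  rewrite -[c]/((z - y) / (z - x) * x + (1 - (z - y) / (z - x)) * z).
  by field; lra.
rewrite -(ler_pM2l zx0) => /le_trans; apply; rewrite le_eqVlt; apply/orP; left.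
by apply/eqP; field; lra.
Qed.

(** The slope is the supremum of the slopes of the chords joining [y] to a point
    on its left; the three-point inequality puts it below the slopes of the
    chords to the right. *)
Lemma convex_subgradient (y : R) : 0 < y ->
  exists al : R, forall x : R, 0 <= x -> f y + al * (x - y) <= f x.
Proof.
move=> y0; pose A := [set (f y - f x) / (y - x) | x in `[0, y[%classic].
have A0 : A !=set0 by exists ((f y - f 0) / (y - 0)); exists 0; rewrite //= in_itv/= lexx.
have ubA z : y < z -> ubound A ((f z - f y) / (z - y)).
  move=> yz s [x /=]; rewrite in_itv/= => /andP[x0 xy] <-{s}.
  rewrite ler_pdivrMr ?subr_gt0// mulrAC ler_pdivlMr ?subr_gt0//.
  by have := convex_three_points x0 xy yz; lra.
have hA : has_sup A by split=> //; exists ((f (y + 1) - f y) / (y + 1 - y)); apply: ubA; lra.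
exists (sup A) => x x0; have [xy|yx|->] := ltgtP x y; last by rewrite subrr mulr0 addr0.
- have : (f y - f x) / (y - x) <= sup A.
    by apply: sup_ubound; [exact: hA.2|exists x; rewrite //= in_itv/= x0].
  rewrite ler_pdivrMr ?subr_gt0//; lra.
- have : sup A <= (f x - f y) / (x - y) by apply: ge_sup => //; exact: ubA.
  rewrite ler_pdivlMr ?subr_gt0//; lra.
Qed.

End convex.

(** * Sub-Markovian forms and Jensen's inequality *)

Section sub_markov_functional.
Context d (X : measurableType d) (R : realType).
Variables (m : {measure set X -> \bar R}) (p : R) (p1 : (1 <= p%:E)%E).
Local Notation Lp := (LspaceType m p1).
Implicit Types (u v w : Lp).

Variable Phi : Lp -> R.
Hypothesis bPhi : bounded_form Phi.
Hypothesis Phi01 : forall u, {ae m, forall x, 0 <= u x <= 1} -> 0 <= Phi u <= 1.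

(** The hypothesis only speaks of functions with values in [0, 1]; it applies to
    [minr u n / n], and truncations converge to [u]. *)
Lemma sub_markov_functional_ge0 u : ae_nonneg u -> 0 <= Phi u.
Proof.
move=> u0; have [w wE wu] := Lspace_truncation u.
rewrite -(cvg_lim _ (bform_cvg bPhi wu))//; apply: limr_ge.
  by apply/cvg_ex; exists (Phi u); exact: bform_cvg wu.
exists 1%N => // n /= n0; have n1 : 0 < n%:R :> R by rewrite ltr0n.
have : 0 <= Phi (n%:R^-1 *: w n) <= 1.
  apply: Phi01; apply: filterS3 (LspaceZ n%:R^-1 (w n)) (wE n) u0.
  move=> x /(_ I) -> /(_ I) -> ux; rewrite mulr_ge0 ?invr_ge0 ?ler0n//=.
    by rewrite ler_pdivrMl// mulr1 ge_min lexx orbT.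
  by rewrite le_min ux ler0n.
by rewrite bformZ// => /andP[+ _]; rewrite pmulr_rge0// invr_gt0.
Qed.

(** Compare [u] with its positive part [w]: since [w / b] has values in [0, 1],
    [Phi w <= b]. This replaces evaluating [Phi] at the constant [b], which need
    not belong to the space. *)
Lemma sub_markov_functional_le u (b : R) : 0 <= b ->
  {ae m, forall x, u x <= b} -> Phi u <= b.
Proof.
rewrite le_eqVlt => /predU1P[<- u0|b0 ub].
  rewrite -oppr_ge0 -bformN//; apply: sub_markov_functional_ge0.
  by apply: filterS2 (LspaceN u) u0 => x /(_ I) ->; rewrite oppr_ge0.
have [w wE] : exists w : Lp, (w : X -> R) = (fun x => maxr (u x) 0) %[ae m].
  apply: (@Lspace_dominated _ _ _ _ _ _ _ u) => [|x].
    by apply: measurable_maxr => //; exact: measurable_Lspace.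
  have [_|u0] := leP (u x) 0; first by rewrite normr0.
  by [].
have : Phi u <= Phi w.
  rewrite -subr_ge0 -bformB//; apply: sub_markov_functional_ge0.
  apply: filterS3 (LspaceD w (- u)) (LspaceN u) wE => x /(_ I) -> /(_ I) -> /(_ I) ->.
  by rewrite subr_ge0 le_max lexx.
move=> /le_trans; apply.
have : 0 <= Phi (b^-1 *: w) <= 1.
  apply: Phi01; apply: filterS3 (LspaceZ b^-1 w) wE ub.
  move=> x /(_ I) -> /(_ I) -> ux; rewrite mulr_ge0 ?invr_ge0 ?(ltW b0)//=.
    by rewrite ler_pdivrMl// mulr1 ge_max ux ltW.
  by rewrite le_max lexx orbT.
by rewrite bformZ// => /andP[_]; rewrite ler_pdivrMl// mulr1.
Qed.

(** Only the supporting line of [f] at [Phi u], say [al * x - b], is involved. As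
    [f 0 = 0], its value at [0] is nonpositive, so [b >= 0]; and
    [al * u - v <= b] almost everywhere gives [al * Phi u - Phi v <= b], which is
    the claim because [f (Phi u) = al * Phi u - b]. *)
Lemma sub_markov_functional_jensen (f : R -> R) u v :
  (forall s : R, 0 <= s -> 0 <= f s) ->
  convex_function (`[0, +oo[%classic : set R) f -> f 0 = 0 ->
  ae_nonneg u -> (v : X -> R) = f \o u %[ae m] -> f (Phi u) <= Phi v.
Proof.
move=> f_ge0 fc f0 u0 vE.
have := sub_markov_functional_ge0 u0; rewrite le_eqVlt => /predU1P[<-|y0].
  rewrite f0; apply: sub_markov_functional_ge0.
  by apply: filterS2 vE u0 => x /(_ I) -> /f_ge0.
have [al al_f] := convex_subgradient fc y0.
(* The right-hand side is minus the value at 0 of the supporting line. *)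
suff : Phi (al *: u - v) <= al * Phi u - f (Phi u).
  by rewrite bformB// bformZ// lerD2l lerN2.
apply: sub_markov_functional_le.
  by have := al_f _ (lexx 0); rewrite f0; lra.
apply: filterS3 (LspaceD (al *: u) (- v)) (LspaceN v)
  (filterI (LspaceZ al u) (filterI vE u0)).
move=> x /(_ I) -> /(_ I) -> [/(_ I) -> [/(_ I) -> /= ux]].
have := al_f _ ux; lra.
Qed.

End sub_markov_functional.

(** * Bochner integrals seen through bounded forms *)

Section bochner_form.
Context d (T : measurableType d) (R : realType) (E : normedModType R).
Variables (mu : {measure set T -> \bar R}) (D : set T).
Hypothesis mD : measurable D.
Variable Phi : E -> R.
Hypothesis bPhi : bounded_form Phi.

(** The error [`|sn n x - g x|] of a Bochner approximation is measurable only up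
    to a null set; as the integral is a supremum over simple functions below the
    integrand, monotonicity survives when only the smaller function [h] is
    measurable. *)
Lemma ae_ge0_le_integral_nonmeasurable (h k : T -> \bar R) :
  measurable_fun D h -> (forall x, D x -> 0 <= h x)%E ->
  (forall x, D x -> 0 <= k x)%E -> {ae mu, forall x, D x -> (h x <= k x)%E} ->
  (\int[mu]_(x in D) h x <= \int[mu]_(x in D) k x)%E.
Proof.
move=> mh h0 k0 [N [mN N0 hkN]].
rewrite (ge0_negligible_integral mN)// integral_mkcond [leRHS]integral_mkcond.
have h'0 x : (0 <= (h \_ (D `\` N)) x)%E by apply: erestrict_ge0 => y [/h0].
rewrite ge0_integralTE// ge0_integralTE; last by move=> x; exact: erestrict_ge0.
apply: le_ereal_sup => _ /= [s sh <-]; exists s => // x.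
apply: le_trans (sh x) _; rewrite !patchE.
case: ifPn => [/[!inE] -[Dx Nx]|_]; last by case: ifPn => // /[!inE] /k0.
rewrite mem_set//; apply: contrapT => hk; apply: Nx; apply: hkN => /= /(_ Dx).
exact: hk.
Qed.

Lemma simple_fun_form_sum (s : T -> E) : simple_fun mu D s ->
  forall x, D x -> Phi (s x) =
    \sum_(y <- finmap.enum_fset (fset_set (s @` D))) Phi y * \1_(D `&` s @^-1` [set y]) x.
Proof.
move=> [sfin ms ms_fin] x Dx.
rewrite (bigD1_seq (s x)) /=; last 2 first.
- by rewrite in_fset_set// inE; exists x.
- exact: finmap.fset_uniq.
rewrite indicE mem_set// mulr1 big1 ?addr0// => y ysx.
rewrite indicE memNset ?mulr0//= => -[_ /= yE].
by rewrite yE eqxx in ysx.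
Qed.

(** The fibre over [0] may have infinite measure, but there [Phi 0 = 0]. *)
Lemma simple_fun_term_integrable (s : T -> E) y : simple_fun mu D s ->
  mu.-integrable D (EFin \o (fun x => Phi y * \1_(D `&` s @^-1` [set y]) x)) /\
  (\int[mu]_(x in D) (Phi y * \1_(D `&` s @^-1` [set y]) x)%:E =
    (Phi (fine (mu (D `&` s @^-1` [set y])) *: y))%:E)%E.
Proof.
move=> [sfin ms ms_fin]; rewrite bformZ//.
have [->|y0] := eqVneq y 0.
  rewrite bform0// mulr0; split.
    under eq_fun do rewrite /= mul0r.
    exact: integrable0.
  by under eq_integral do rewrite mul0r; rewrite integral0.
have i1 : mu.-integrable D (EFin \o \1_(D `&` s @^-1` [set y])).
  apply/integrableP; split.
    by apply/measurable_EFinP; apply: measurable_indic.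
  under eq_integral do rewrite /= ger0_norm//.
  by rewrite integral_indic// setIAC setIid ms_fin.
split.
  by apply: eq_integrable (integrableZl mD (Phi y) i1) => // x _; rewrite /= EFinM.
under eq_integral do rewrite EFinM.
rewrite integralZl// integral_indic// setIAC setIid mulrC EFinM fineK//.
by rewrite ge0_fin_numE// ms_fin.
Qed.

Lemma simple_fun_form_integrable (s : T -> E) : simple_fun mu D s ->
  mu.-integrable D (EFin \o (Phi \o s)) /\
  \int[mu]_(x in D) Phi (s x) = Phi (simple_integral mu D s).
Proof.
move=> ss; have [sfin _ _] := ss.
have sE x : D x -> ((Phi (s x))%:E = \sum_(y <- finmap.enum_fset (fset_set (s @` D)))
    (Phi y * \1_(D `&` s @^-1` [set y]) x)%:E)%E.
  by move=> Dx; rewrite sumEFin (simple_fun_form_sum ss).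
split.
  apply: (@eq_integrable _ _ _ _ _ mD (fun x => \sum_(y <- finmap.enum_fset (fset_set (s @` D)))
    (Phi y * \1_(D `&` s @^-1` [set y]) x)%:E)%E).
    by move=> x /[!inE] Dx; rewrite /= sE.
  apply: integrable_sum => // y _ .
  exact: (simple_fun_term_integrable y ss).1.
rewrite /Rintegral (eq_integral (fun x => \sum_(y <- finmap.enum_fset (fset_set (s @` D)))
    (Phi y * \1_(D `&` s @^-1` [set y]) x)%:E)%E); last first.
  by move=> x /[!inE] Dx; exact: sE.
rewrite integral_sum//; last by move=> y; exact: (simple_fun_term_integrable y ss).1.
rewrite /simple_integral fsbig_finite//= (big_morph _ (bformD bPhi) (bform0 bPhi)).
under eq_bigr do rewrite (simple_fun_term_integrable _ ss).2.
by rewrite sumEFin.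
Qed.

(** [Phi \o g] is an almost everywhere limit of the measurable [Phi \o sn n]; it
    becomes measurable once it is set to [0] on the exceptional null set. *)
Lemma bochner_form_ae sn (g : T -> E) : bochner_approx mu D sn g ->
  exists2 k : T -> R, measurable_fun D k & {ae mu, forall x, D x -> k x = Phi (g x)}.
Proof.
move=> [ss [N [mN N0 sgN]] _].
exists (fun x => Phi (g x) * \1_(~` N) x).
  apply: (@measurable_fun_cvg _ _ _ _ (fun n x => Phi (sn n x) * \1_(~` N) x)).
    move=> n; apply: measurable_funM.
      by apply/measurable_EFinP; exact: measurable_int (simple_fun_form_integrable (ss n)).1.
    by apply: measurable_indic; exact: measurableC.
  move=> x Dx; rewrite indicE; have [xN|xN] := boolP (x \in ~` N); last first.
    by rewrite mulr0; under eq_fun do rewrite mulr0; exact: cvg_cst.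
  rewrite mulr1; under eq_fun do rewrite mulr1; apply: bform_cvg => //.
  apply: contrapT => sg; move: xN; rewrite inE; apply; apply: sgN => /= /(_ Dx).
  exact: sg.
exists N; split=> // x /= kg; apply: contrapT => Nx; apply: kg => Dx.
by rewrite indicE mem_set// mulr1.
Qed.

(** The integrals of [Phi \o sn n] are the images under [Phi] of the integrals of
    the approximating simple functions, and they converge to the integral of [k]
    since [`|Phi (sn n x) - k x|] is at most a constant times
    [`|sn n x - g x|] almost everywhere. *)
Lemma bochner_form_integral (g : T -> E) v (k : T -> R) :
  has_bochner_integral mu D g v -> measurable_fun D k ->
  {ae mu, forall x, D x -> k x = Phi (g x)} ->
  mu.-integrable D (EFin \o k) /\ \int[mu]_(x in D) k x = Phi v.
Proof.
move=> [sn [ss sg sg0] sv] mk kg.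
have [C0 C0_ge0 PhiC0] := bform_bound bPhi.
pose C := C0 + 1; have C_gt0 : 0 < C by rewrite ltr_wpDl.
have PhiC x : `|Phi x| <= C * `|x|.
  by rewrite (le_trans (PhiC0 x))// ler_wpM2r// lerDl.
pose e n x : R := `|Phi (sn n x) - k x|.
have iPs n : mu.-integrable D (EFin \o (Phi \o sn n)).
  exact: (simple_fun_form_integrable (ss n)).1.
have mPs n : measurable_fun D (Phi \o sn n).
  by apply/measurable_EFinP; exact: measurable_int (iPs n).
have me n : measurable_fun D (e n).
  by rewrite /e; apply: measurableT_comp => //; apply: measurable_funB => //; exact: mPs.
have eC n : (\int[mu]_(x in D) (C^-1 * e n x)%:E <=
    \int[mu]_(x in D) `|sn n x - g x|%:E)%E.
  apply: ae_ge0_le_integral_nonmeasurable.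
  - by apply/measurable_EFinP; exact: measurable_funM.
  - by move=> x _; rewrite lee_fin mulr_ge0 ?normr_ge0// invr_ge0 ltW.
  - by move=> x _; rewrite lee_fin.
  - apply: filterS kg => x kg Dx; rewrite lee_fin ler_pdivrMl// /e kg//.
    by rewrite -bformB.
have ie n : (\int[mu]_(x in D) (C^-1 * e n x)%:E = C^-1%:E * \int[mu]_(x in D) (e n x)%:E)%E.
  under eq_integral do rewrite EFinM.
  rewrite ge0_integralZl_EFin//.
  - by move=> x _; rewrite lee_fin normr_ge0.
  - exact/measurable_EFinP.
  - by rewrite invr_ge0 ltW.
have e0 r : 0 < r -> \forall n \near \oo, (\int[mu]_(x in D) (e n x)%:E < r%:E)%E.
  move=> r0; move/fine_cvgP : sg0 => [sfin /cvgrPdist_lt/(_ (C^-1 * r))].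
  rewrite mulr_gt0 ?invr_gt0// => /(_ isT) => sr.
  apply: filterS2 sfin sr => n nfin; rewrite /= sub0r normrN => nr.
  have : (\int[mu]_(x in D) `|sn n x - g x|%:E < (C^-1 * r)%:E)%E.
    by rewrite -(fineK nfin) lte_fin (le_lt_trans (ler_norm _)).
  move=> /(le_lt_trans (eC n)); rewrite ie EFinM lte_pmul2l// lte_fin invr_gt0//.
have ie_fin n r : (\int[mu]_(x in D) (e n x)%:E < r%:E)%E ->
    mu.-integrable D (EFin \o (fun x => Phi (sn n x) - k x)).
  move=> er; apply/integrableP; split.
    by apply/measurable_EFinP; apply: measurable_funB => //; exact: mPs.
  by rewrite (lt_trans er)// ltry.
have ik : mu.-integrable D (EFin \o k).
  have [n _ /(_ n (leqnn n))/= /ie_fin in1] := e0 1 ltr01.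
  apply: eq_integrable (integrableB mD (iPs n) in1) => // x _ /=.
  by rewrite -EFinB opprB addrCA subrr addr0.
split=> //.
have : \int[mu]_(x in D) Phi (sn n x) @[n --> \oo] --> \int[mu]_(x in D) k x.
  apply/cvgrPdist_lt => r r0; apply: filterS (e0 _ r0) => n er.
  rewrite distrC -RintegralB//; last exact: iPs.
  have in1 := ie_fin _ _ er.
  rewrite (le_lt_trans (le_normr_Rintegral mD in1))//.
  rewrite -lte_fin /Rintegral fineK//.
  by apply: integrable_fin_num => //; exact: integrable_norm.
move=> /cvg_lim <-//; apply/cvg_lim => //.
rewrite (_ : (fun n => _) = (fun n => Phi (simple_integral mu D (sn n)))).
  exact: bform_cvg.
by apply/funext => n; exact: (simple_fun_form_integrable (ss n)).2.
Qed.

End bochner_form.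

(** * The Osgood integral and blow-up of scalar inequalities *)

Section osgood.
Context (R : realType) (f : R -> R).
Notation mu := (@lebesgue_measure R).
Hypothesis f_convex : convex_function (`[0, +oo[%classic : set R) f.
Hypothesis f_continuous : {within `[0, +oo[, continuous f}.
Hypothesis f0 : f 0 = 0.
Hypothesis f_gt0 : forall s : R, 0 < s -> 0 < f s.
Hypothesis f_integral : (\int[mu]_(s in `[1%R, +oo[) ((f s)^-1)%:E < +oo)%E.

Lemma convex_nondecreasing (x y : R) : 0 <= x -> x <= y -> f x <= f y.
Proof.
rewrite le_eqVlt => /predU1P[<-|x0 xy].
  by rewrite le_eqVlt => /predU1P[->//|/f_gt0/ltW]; rewrite f0.
have [al alf] := convex_subgradient f_convex x0.
have := alf _ (lexx 0); rewrite f0 => alx.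
have al0 : 0 <= al.
  rewrite -(pmulr_lge0 _ x0); have := f_gt0 x0; lra.
apply: le_trans (alf y _); last exact: le_trans (ltW x0) xy.
by rewrite lerDl mulr_ge0// subr_ge0.
Qed.

(** Real powers are measurable, and the power [-1] is the inverse on nonnegative
    numbers. *)
Lemma measurable_inv_f (D : set R) : measurable D -> D `<=` `]0, +oo[ ->
  measurable_fun D (fun s => (f s)^-1).
Proof.
move=> mD D0; apply: (@eq_measurable_fun _ _ _ _ D (fun s => f s `^ (-1))).
  move=> x /[!inE] /D0/=; rewrite in_itv/= andbT => x0.
  by rewrite powR_inv1// ltW// f_gt0.
apply: (measurableT_comp (measurable_powR _)).
have mf0 : measurable_fun (`[0, +oo[%classic : set R) f.
  exact: subspace_continuous_measurable_fun.
apply: (measurable_funS _ _ mf0) => //.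
by move=> x /D0 /=; rewrite !in_itv/= !andbT => /ltW.
Qed.

Lemma inv_f_ge0 (x : R) : 0 < x -> 0 <= (f x)^-1.
Proof. by move=> x0; rewrite invr_ge0 ltW// f_gt0. Qed.

Lemma integrable_inv_f_itv (t u : R) : 0 < t ->
  mu.-integrable `[t, u[ (EFin \o (fun s => (f s)^-1)).
Proof.
move=> t0; apply: measurable_bounded_integrable => //.
- by rewrite /= lebesgue_measure_itv/=; case: ifPn => //; rewrite -EFinB ltry.
- apply: measurable_inv_f => // x /=; rewrite !in_itv/= andbT => /andP[+ _].
  exact: lt_le_trans.
- exists (f t)^-1; split; first exact: num_real.
  move=> M /ltW tM x /=; rewrite in_itv/= => /andP[tx _].
  have x0 := lt_le_trans t0 tx.
  rewrite ger0_norm ?inv_f_ge0// (le_trans _ tM)// lef_pV2 ?posrE ?f_gt0//.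
  by apply: convex_nondecreasing => //; exact: ltW.
Qed.

Lemma integrable_inv_f (t : R) : 0 < t ->
  mu.-integrable `[t, +oo[ (EFin \o (fun s => (f s)^-1)).
Proof.
move=> t0.
have i1 : mu.-integrable `[1%R, +oo[ (EFin \o (fun s => (f s)^-1)).
  apply/integrableP; split.
    apply/measurable_EFinP; apply: measurable_inv_f; first exact: measurable_itv.
    by move=> x /=; rewrite !in_itv/= !andbT; exact: lt_le_trans.
  apply: le_lt_trans f_integral; rewrite le_eqVlt; apply/orP; left; apply/eqP.
  apply: eq_integral => x /[!inE]/=; rewrite in_itv/= andbT => x1.
  by rewrite ger0_norm// inv_f_ge0// (lt_le_trans ltr01).
have iU : mu.-integrable (`[t, 1%R[ `|` `[1%R, +oo[) (EFin \o (fun s => (f s)^-1)).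
  have mU : measurable_fun (`[t, 1%R[ `|` `[1%R, +oo[) (EFin \o (fun s => (f s)^-1)).
    apply/measurable_EFinP; apply: measurable_inv_f; first exact: measurableU.
    move=> x /= [|]; rewrite !in_itv/= !andbT.
      by move=> /andP[+ _]; exact: lt_le_trans.
    exact: lt_le_trans.
  apply/integrableP; split => //; rewrite ge0_integral_setU//.
  - apply: lte_add_pinfty; last by have /integrableP[] := i1.
    by have /integrableP[] := @integrable_inv_f_itv t 1 t0.
  - exact: measurableT_comp.
  - apply/disj_setPS => x /=; rewrite !in_itv/= andbT => -[/andP[_ x1]].
    by rewrite leNgt x1.
apply: (integrableS _ _ _ iU) => //; first exact: measurableU.
move=> x /=; rewrite !in_itv/= !andbT => tx.
by have [x1|x1] := ltP x 1; [left; rewrite tx|right].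
Qed.

Lemma osgood_split (t u : R) : 0 < t -> t <= u ->
  osgood f t = \int[mu]_(s in `[t, u[) (f s)^-1 + osgood f u.
Proof.
move=> t0 tu; rewrite /osgood -Rintegral_setU//.
- congr (Rintegral _ _ _); apply/seteqP; split => x /=; rewrite !in_itv/= !andbT.
    by move=> tx; have [xu|xu] := ltP x u; [left; rewrite tx|right].
  by move=> [/andP[]//|]; exact: le_trans.
- apply: (integrableS _ _ _ (integrable_inv_f t0)) => //; first exact: measurableU.
  move=> x /= [|]; rewrite !in_itv/= !andbT; first by move=> /andP[].
  exact: le_trans.
- apply/disj_setPS => x /=; rewrite !in_itv/= andbT => -[/andP[_ x1]].
  by rewrite leNgt x1.
Qed.

Lemma integrable_cst_itv (t u c : R) : mu.-integrable `[t, u[ (EFin \o cst c).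
Proof.
apply: measurable_bounded_integrable => //.
  by rewrite /= lebesgue_measure_itv/=; case: ifPn => //; rewrite -EFinB ltry.
by exists `|c|; split=> [|M /ltW cM x _ /=]; first exact: num_real.
Qed.

Lemma Rintegral_itv_cst (t u c : R) : t <= u -> \int[mu]_(s in `[t, u[) c = c * (u - t).
Proof.
move=> tu; rewrite Rintegral_cst//= lebesgue_measure_itv/= lte_fin.
by move: tu; rewrite le_eqVlt => /predU1P[->|->//]; rewrite ltxx subrr.
Qed.

(** The integrand is at least [(f u)^-1] on [`[t, u[], as [f] is nondecreasing. *)
Lemma osgood_diff_ge (t u : R) : 0 < t -> t <= u ->
  (u - t) / f u <= osgood f t - osgood f u.
Proof.
move=> t0 tu; rewrite (osgood_split t0 tu) addrK mulrC -Rintegral_itv_cst//.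
apply: le_Rintegral => //.
- exact: integrable_cst_itv.
- exact: integrable_inv_f_itv.
- move=> x /=; rewrite in_itv/= => /andP[tx xu]; have x0 := lt_le_trans t0 tx.
  rewrite lef_pV2 ?posrE ?f_gt0 ?(lt_trans x0 xu)//.
  by apply: convex_nondecreasing; rewrite ltW.
Qed.

Lemma osgood_diff_le (t u : R) : 0 < t -> t <= u ->
  osgood f t - osgood f u <= (u - t) / f t.
Proof.
move=> t0 tu; rewrite (osgood_split t0 tu) addrK mulrC -Rintegral_itv_cst//.
apply: le_Rintegral => //.
- exact: integrable_inv_f_itv.
- exact: integrable_cst_itv.
- move=> x /=; rewrite in_itv/= => /andP[tx xu]; have x0 := lt_le_trans t0 tx.
  rewrite lef_pV2 ?posrE ?f_gt0//.
  by apply: convex_nondecreasing => //; rewrite ltW.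
Qed.

Lemma osgood_ge0 (t : R) : 0 < t -> 0 <= osgood f t.
Proof.
move=> t0; apply: Rintegral_ge0 => x /=; rewrite in_itv/= andbT => tx.
by rewrite inv_f_ge0// (lt_le_trans t0).
Qed.

Lemma osgood_gt0 (t : R) : 0 < t -> 0 < osgood f t.
Proof.
move=> t0; have t1 : t <= t + 1 by rewrite lerDl.
have := osgood_diff_ge t0 t1; have := osgood_ge0 (lt_le_trans t0 t1).
have : 0 < (t + 1 - t) / f (t + 1).
  by rewrite addrAC subrr add0r divr_gt0// f_gt0// (lt_le_trans t0).
lra.
Qed.

Lemma osgood_nonincreasing (t u : R) : 0 < t -> t <= u -> osgood f u <= osgood f t.
Proof.
move=> t0 tu; rewrite -subr_ge0 (le_trans _ (osgood_diff_ge t0 tu))//.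
by rewrite divr_ge0 ?subr_ge0// ltW// f_gt0// (lt_le_trans t0).
Qed.

Lemma osgood_continuous (a b : R) : 0 < a -> {within `[a, b], continuous (osgood f)}.
Proof.
move=> a0.
have lip (x y : R) : a <= x -> x <= y -> osgood f x - osgood f y <= (y - x) / f a.
  move=> ax xy; have x0 := lt_le_trans a0 ax.
  rewrite (le_trans (osgood_diff_le x0 xy))// ler_wpM2l ?subr_ge0//.
  by rewrite lef_pV2 ?posrE ?f_gt0// convex_nondecreasing// ltW.
apply/subspace_continuousP => x /=; rewrite in_itv/= => /andP[ax xb].
apply/cvgrPdist_lt => e e0.
rewrite near_withinE.
exists (e * f a); first by rewrite /= mulr_gt0// f_gt0.
move=> y /= xye; rewrite in_itv/= => /andP[ay yb].
apply: (@le_lt_trans _ _ (`|x - y| / f a)); last by rewrite ltr_pdivrMr ?f_gt0.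
have [xy|/ltW yx] := leP x y.
- rewrite ger0_norm ?subr_ge0 ?osgood_nonincreasing ?(lt_le_trans a0)//.
  by rewrite distrC (ger0_norm (_ : 0 <= y - x)) ?subr_ge0//; exact: lip.
- rewrite distrC ger0_norm ?subr_ge0 ?osgood_nonincreasing ?(lt_le_trans a0)//.
  by rewrite (ger0_norm (_ : 0 <= x - y)) ?subr_ge0//; exact: lip.
Qed.

(** By convexity [f s <= f 1 * s] on [0, 1], so that each dyadic interval
    [`[2^-(n+1), 2^-n[] contributes at least [(2 * f 1)^-1]. *)
Lemma osgood_unbounded (T : R) : exists2 t : R, 0 < t & T <= osgood f t.
Proof.
have f1 : 0 < f 1 by exact: f_gt0.
have fle n : f (2^-1 ^+ n) <= 2^-1 ^+ n * f 1.
  case: n => [|n]; first by rewrite expr0 mul1r.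
  have n0 : 0 < 2^-1 ^+ n.+1 :> R by rewrite exprn_gt0// invr_gt0.
  have n1 : 2^-1 ^+ n.+1 < 1 :> R by rewrite exprn_ilt1// ?invr_ge0// invf_lt1// ltr1n.
  by have := convex_three_points f_convex (lexx 0) n0 n1; rewrite f0; lra.
have step n : n%:R / (2 * f 1) <= osgood f (2^-1 ^+ n).
  elim: n => [|n ih]; first by rewrite mul0r osgood_ge0.
  have n0 : 0 < 2^-1 ^+ n :> R by rewrite exprn_gt0// invr_gt0.
  have Sn0 : 0 < 2^-1 ^+ n.+1 :> R by rewrite exprn_gt0// invr_gt0.
  have h := @osgood_diff_ge (2^-1 ^+ n.+1) (2^-1 ^+ n) Sn0.
  have {}h : (2 * f 1)^-1 <= osgood f (2^-1 ^+ n.+1) - osgood f (2^-1 ^+ n).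
    apply: le_trans (h _); last by rewrite exprS; lra.
    have -> : 2^-1 ^+ n - 2^-1 ^+ n.+1 = (2 * f 1)^-1 * (2^-1 ^+ n * f 1).
      by rewrite exprS; field; rewrite gt_eqF.
    by rewrite ler_pdivlMr ?f_gt0// ler_wpM2l// invr_ge0 mulr_ge0// ltW.
  by rewrite -natr1 mulrDl mul1r; lra.
pose n := (Num.truncn (`|T| * (2 * f 1))).+1.
exists (2^-1 ^+ n); first by rewrite exprn_gt0// invr_gt0.
apply: le_trans (step n); rewrite ler_pdivlMr ?mulr_gt0//.
rewrite (@le_trans _ _ (`|T| * (2 * f 1)))//; last by rewrite ltW// truncnS_gt.
by rewrite ler_wpM2r ?ler_norm// ltW// mulr_gt0.
Qed.

Lemma osgood_vanishes (T : R) : 0 < T -> exists2 t : R, 0 < t & osgood f t <= T.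
Proof.
move=> T0; pose F n : set R := `[1%R, n.+1%:R[%classic.
have FE : \bigcup_n F n = `[1%R, +oo[%classic.
  apply/seteqP; split => x; first by move=> [n _] /=; rewrite /F/= !in_itv/= => /andP[->].
  rewrite /= in_itv/= andbT => x1; exists (Num.truncn x) => //=.
  by rewrite /F/= in_itv/= x1 truncnS_gt.
have : (\int[mu]_(x in F n) ((f x)^-1)%:E @[n --> \oo] -->
    \int[mu]_(x in \bigcup_n F n) ((f x)^-1)%:E)%E.
  apply: ge0_nondecreasing_set_cvg_integral => //.
  - move=> m n mn; apply/subsetPset => x; rewrite /F/= !in_itv/= => /andP[->] /lt_le_trans -> //.
    by rewrite ler_nat ltnS.
  - move=> i; exact: measurable_itv.
  - by move=> i; apply: measurable_int; exact: integrable_inv_f_itv.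
  - move=> i x; rewrite /F/= in_itv/= => /andP[x1 _].
    by rewrite lee_fin inv_f_ge0// (lt_le_trans ltr01).
rewrite FE; have i1 := integrable_inv_f ltr01.
rewrite -(fineK (integrable_fin_num _ i1))//.
move=> /fine_cvgP[_ /cvgrPdist_lt/(_ _ T0)[n _ /(_ n (leqnn n))/=]].
rewrite -/(Rintegral _ _ _) -/(Rintegral _ _ _) -/(osgood f 1) => h.
exists n.+1%:R; first by rewrite ltr0n.
have := osgood_split ltr01 (_ : 1 <= n.+1%:R); rewrite ler1n => /(_ isT) E.
move: h; rewrite E addrAC subrr add0r => /ltW; apply: le_trans.
exact: ler_norm.
Qed.

(** This makes [osgood_inv f T] a genuine preimage of every [T > 0].  The proof
    is the intermediate value theorem, [osgood f] being locally Lipschitz. *)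
Lemma osgood_surjective : set_surj `]0, +oo[ `]0, +oo[ (osgood f).
Proof.
move=> T /=; rewrite in_itv/= andbT => T0.
have [a a0 Ta] := osgood_unbounded T.
have [b b0 bT] := osgood_vanishes T0.
have [ab|ba] := leP a b.
  have Tab : minr (osgood f a) (osgood f b) <= T <= maxr (osgood f a) (osgood f b).
    by rewrite ge_min bT orbT/= le_max Ta.
  have [c] := IVT ab (@osgood_continuous a b a0) Tab.
  rewrite in_itv/= => /andP[ac cb] cT; exists c => //=.
  by rewrite in_itv/= andbT (lt_le_trans a0).
exists a => /=; first by rewrite in_itv/= andbT.
apply/eqP; rewrite eq_le Ta andbT (le_trans _ bT)//.
by rewrite osgood_nonincreasing// ltW.
Qed.

Lemma osgood_le_of_gt_inv (T A : R) : 0 < T -> osgood_inv f T < A ->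
  0 < A /\ osgood f A <= T.
Proof.
move=> T0 TA; have T0' : `]0, +oo[%classic T by rewrite /= in_itv/= andbT.
have : `]0, +oo[%classic (osgood_inv f T).
  by apply: (surjpinv_image_sub osgood_surjective); exists T.
rewrite /= in_itv/= andbT => i0; split; first exact: lt_trans TA.
rewrite -[leRHS](surjpK (fun=> 0) osgood_surjective (mem_set T0')).
by apply: osgood_nonincreasing => //; exact: ltW.
Qed.

(** The hypothesis is the integrated form of [y' >= f (y)].  On a step from [s] to [t],
    [osgood f (y s) - osgood f (y t) >= (t - s) * (f (y s) / f (y t))], and
    [r >= 1 + ln r] bounds this below by
    [(t - s) * (1 + ln (f (y s)) - ln (f (y t)))]. Over [N] equal steps the
    logarithms telescope and contribute [O (1 / N)], so
    [osgood f (y 0) - osgood f (y T) >= T]; and [osgood f (y T) > 0]. *)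
Lemma osgood_lifespan (y : R -> R) (T : R) : 0 < T -> 0 < y 0 ->
  (forall s t : R, 0 <= s -> s <= t -> t <= T -> (t - s) * f (y s) <= y t - y s) ->
  T < osgood f (y 0).
Proof.
move=> T0 y0 yf.
have y_ge t : 0 <= t -> t <= T -> y 0 <= y t.
  move=> t0 tT; rewrite -subr_ge0 (le_trans _ (yf _ _ (lexx 0) t0 tT))//.
  by rewrite mulr_ge0 ?subr_ge0// ltW// f_gt0.
have y_gt0 t : 0 <= t -> t <= T -> 0 < y t.
  by move=> t0 tT; rewrite (lt_le_trans y0)// y_ge.
have step s t : 0 <= s -> s <= t -> t <= T ->
    (t - s) * (1 + ln (f (y s)) - ln (f (y t))) <= osgood f (y s) - osgood f (y t).
  move=> s0 st tT; have ys0 := y_gt0 _ s0 (le_trans st tT).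
  have yt0 := y_gt0 _ (le_trans s0 st) tT.
  have yst : y s <= y t.
    rewrite -subr_ge0 (le_trans _ (yf _ _ s0 st tT))// mulr_ge0 ?subr_ge0//.
    by rewrite ltW// f_gt0.
  (* Bound the quotient by 1 + ln, so that a sum over steps telescopes. *)
  apply: le_trans (osgood_diff_ge ys0 yst).
  apply: (@le_trans _ _ ((t - s) * (f (y s) / f (y t)))).
    rewrite ler_wpM2l ?subr_ge0//.
    have r0 : 0 < f (y s) / f (y t) by rewrite divr_gt0 ?f_gt0.
    have : ln (1 + (f (y s) / f (y t) - 1)) <= f (y s) / f (y t) - 1.
      by apply: le_ln1Dx; lra.
    by rewrite addrC subrK ln_div ?posrE ?f_gt0//; lra.
  by rewrite mulrA ler_wpM2r// ?yf// invr_ge0 ltW// f_gt0.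
have riemann (N : nat) : (0 < N)%N ->
    T - T / N%:R * (ln (f (y T)) - ln (f (y 0))) <= osgood f (y 0) - osgood f (y T).
  move=> N0; have N_gt0 : 0 < N%:R :> R by rewrite ltr0n.
  pose h := T / N%:R; have h0 : 0 < h by rewrite divr_gt0.
  suff H i : (i <= N)%N -> i%:R * h - h * (ln (f (y (i%:R * h))) - ln (f (y 0))) <=
      osgood f (y 0) - osgood f (y (i%:R * h)).
    by have := H N (leqnn N); rewrite /h [N%:R * _]mulrC divfK ?gt_eqF.
  elim: i => [|i ih iN]; first by rewrite !mul0r !subrr mulr0 subrr.
  have := ih (ltnW iN).
  have := @step (i%:R * h) (i.+1%:R * h).
  have -> : i.+1%:R * h - i%:R * h = h by rewrite -natr1; ring.
  rewrite mulr_ge0 ?(ltW h0)// => /(_ isT).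
  rewrite ler_wpM2r ?ler_nat ?(ltW h0)// => /(_ isT).
  have -> : i.+1%:R * h <= T.
    by rewrite /h mulrA ler_pdivrMr// mulrC ler_wpM2l ?ler_nat// ltW.
  move=> /(_ isT); have -> : i.+1%:R * h = i%:R * h + h by rewrite -natr1; ring.
  lra.
have oT := osgood_gt0 (y_gt0 _ (ltW T0) (lexx T)).
suff : T <= osgood f (y 0) - osgood f (y T) by lra.
set K := ln (f (y T)) - ln (f (y 0)) in riemann.
rewrite leNgt; apply/negP => lt; set c := _ - _ in lt riemann.
have c0 : 0 < T - c by rewrite subr_gt0.
(* With this many steps the telescoped logarithms are below the gap T - c. *)
pose N := (Num.truncn (T * `|K| / (T - c))).+1.
have := riemann N isT.
have : T / N%:R * K < T - c.
  apply: (@le_lt_trans _ _ (T * `|K| / N%:R)).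
    rewrite mulrAC ler_wpM2r ?invr_ge0// ler_wpM2l ?ler_norm// ltW//.
  rewrite ltr_pdivrMr ?ltr0n// [ltRHS]mulrC -ltr_pdivrMr//.
  exact: truncnS_gt.
lra.
Qed.

End osgood.

Lemma ae_le_Rintegral d (T : measurableType d) (R : realType)
    (mu : {measure set T -> \bar R}) (D : set T) (h k : T -> R) :
  measurable D -> mu.-integrable D (EFin \o h) -> mu.-integrable D (EFin \o k) ->
  {ae mu, forall x, D x -> h x <= k x} ->
  \int[mu]_(x in D) h x <= \int[mu]_(x in D) k x.
Proof.
move=> mD ih ik [N [mN N0 hkN]].
have mDN : measurable (D `\` N) by exact: measurableD.
rewrite /Rintegral (negligible_integral mN mD ih N0) (negligible_integral mN mD ik N0).
apply: le_Rintegral => //.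
- exact: integrableS ih.
- exact: integrableS ik.
- move=> x [Dx Nx]; apply: contrapT => hk; apply: Nx; apply: hkN => /= /(_ Dx).
  exact: hk.
Qed.

Section volterra.
Context (R : realType) (f : R -> R).
Notation mu := (@lebesgue_measure R).

Lemma ae_ge_Rintegral_itv (k : R -> R) (s t c : R) : s <= t ->
  mu.-integrable `]s, t] (EFin \o k) ->
  {ae mu, forall x, `]s, t]%classic x -> c <= k x} ->
  (t - s) * c <= \int[mu]_(x in `]s, t]) k x.
Proof.
move=> st ik ck.
have mst : (mu `]s, t]%classic = (t - s)%:E)%E.
  rewrite /= lebesgue_measure_itv/= lte_fin.
  by move: st; rewrite le_eqVlt => /predU1P[->|->//]; rewrite ltxx subrr.
have -> : (t - s) * c = \int[mu]_(x in `]s, t]) cst c x.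
  by rewrite Rintegral_cst//= mulrC -[t - s]/(fine (t - s)%:E) -mst.
apply: ae_le_Rintegral => //.
apply: measurable_bounded_integrable => //.
  by have : (mu `]s, t]%classic < +oo)%E by rewrite mst ltry.
by exists `|c|; split=> [|M /ltW cM x _ /=]; first exact: num_real.
Qed.

(** Since [k >= f \o y >= 0] almost everywhere, [y] is nondecreasing, and then
    [k >= f (y s)] almost everywhere after time [s]. *)
Lemma volterra_increment (y k : R -> R) (A T : R) :
  (forall s : R, 0 <= s -> 0 <= f s) ->
  (forall s t : R, 0 <= s -> s <= t -> f s <= f t) ->
  mu.-integrable `]0, T] (EFin \o k) ->
  (forall t : R, 0 <= t -> t <= T -> y t = A + \int[mu]_(r in `]0, t]) k r) ->
  (forall t : R, 0 <= t -> t <= T -> 0 <= y t) ->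
  {ae mu, forall r : R, `]0, T]%classic r -> f (y r) <= k r} ->
  forall s t : R, 0 <= s -> s <= t -> t <= T -> (t - s) * f (y s) <= y t - y s.
Proof.
move=> f_ge0 f_nd ik yE y_ge0 fk.
have iS (s t : R) : 0 <= s -> t <= T -> mu.-integrable `]s, t] (EFin \o k).
  move=> s0 tT; apply: integrableS ik => // x /=; rewrite !in_itv/= => /andP[sx xt].
  by rewrite (le_lt_trans s0)//= (le_trans xt).
have yB (s t : R) : 0 <= s -> s <= t -> t <= T -> y t - y s = \int[mu]_(r in `]s, t]) k r.
  move=> s0 st tT; rewrite !yE ?(le_trans st)// ?(le_trans s0)//.
  rewrite opprD addrACA subrr add0r.
  by apply: Rintegral_itvB; rewrite ?bnd_simp//; exact: iS.
have y_nd (s t : R) : 0 <= s -> s <= t -> t <= T -> y s <= y t.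
  move=> s0 st tT; rewrite -subr_ge0 yB// -[leLHS](mulr0 (t - s)).
  apply: ae_ge_Rintegral_itv => //; first exact: iS.
  apply: (@filterS _ _ (ae_filter_ringOfSetsType mu)) fk => x fk.
  rewrite /= in_itv/= => /andP[sx xt].
  have x0 := le_lt_trans s0 sx; have xT := le_trans xt tT.
  by apply: le_trans (fk _); rewrite /= ?in_itv/= ?x0// f_ge0// y_ge0// ltW.
move=> s t s0 st tT; rewrite yB//; apply: ae_ge_Rintegral_itv => //; first exact: iS.
apply: (@filterS _ _ (ae_filter_ringOfSetsType mu)) fk => x fk; rewrite /= in_itv/= => /andP[sx xt].
have x0 := le_lt_trans s0 sx; have xT := le_trans xt tT.
apply: le_trans (fk _); last by rewrite /= in_itv/= x0.
apply: f_nd; last by apply: y_nd => //; exact: ltW.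
by apply: y_ge0 => //; rewrite (le_trans st).
Qed.

End volterra.

(** * Spatial means of a mild solution *)

Section mean.
Context d (X : measurableType d) (R : realType).
Variables (m : {measure set X -> \bar R}) (p : R) (p1 : (1 <= p%:E)%E).
Local Notation Lp := (LspaceType m p1).
Variable G : set X.
Hypotheses (mG : measurable G) (G_gt0 : (0 < m G)%E) (G_fin : (m G < +oo)%E).

Definition mean (u : Lp) : R := (fine (m G))^-1 * \int[m]_(x in G) u x.

Lemma bounded_form_mean : bounded_form mean.
Proof. by apply: bounded_form_scale; exact: bounded_form_Rintegral. Qed.

Lemma mean01 (u : Lp) : {ae m, forall x, 0 <= u x <= 1} -> 0 <= mean u <= 1.
Proof.
move=> u01; have mG0 : 0 < fine (m G) by rewrite fine_gt0// G_gt0.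
have ic c : m.-integrable G (EFin \o cst c).
  apply: measurable_bounded_integrable => //.
  by exists `|c|; split=> [|M /ltW cM x _ /=]; first exact: num_real.
have iu := Lspace_integrable u mG G_fin.
apply/andP; split.
  rewrite mulr_ge0// ?invr_ge0 ?(ltW mG0)//.
  rewrite -(mul0r (fine (m G))) -Rintegral_cst//; apply: ae_le_Rintegral => //; first exact: ic.
  by apply: filterS u01 => x /andP[].
rewrite ler_pdivrMl// mulr1 -[leRHS]mul1r -Rintegral_cst//.
apply: ae_le_Rintegral => //; first exact: ic.
by apply: filterS u01 => x /andP[].
Qed.

End mean.

Section blow_up.
Context d (X : measurableType d) (R : realType).
Variables (m : {measure set X -> \bar R}) (p : R) (p1 : (1 <= p%:E)%E).
Local Notation Lp := (LspaceType m p1).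
Notation mu := (@lebesgue_measure R).
Variables (S : R -> {linear Lp -> Lp}) (f : R -> R) (a : Lp) (T : R) (G : set X).
Hypothesis S_c0 : c0_semigroup S.
Hypothesis S_markov : sub_markovian S.
Hypothesis f_ge0 : forall s : R, 0 <= s -> 0 <= f s.
Hypothesis f_convex : convex_function (`[0, +oo[%classic : set R) f.
Hypothesis f_continuous : {within `[0, +oo[, continuous f}.
Hypothesis f0 : f 0 = 0.
Hypothesis f_gt0 : forall s : R, 0 < s -> 0 < f s.
Hypothesis f_integral : (\int[mu]_(s in `[1%R, +oo[) ((f s)^-1)%:E < +oo)%E.
Hypothesis T_gt0 : 0 < T.
Hypotheses (mG : measurable G) (G_gt0 : (0 < m G)%E) (G_fin : (m G < +oo)%E).
Hypothesis G_mean : osgood_inv f T < mean G (S T a).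

Lemma semigroup_mean_bounded_form r : 0 <= r -> bounded_form (fun u => mean G (S r u)).
Proof.
move=> r0; apply: (@bounded_form_comp _ _ (@mean _ _ _ _ _ p1 G) (S r)).
  exact: bounded_form_mean.
exact: c0_bounded S_c0 _ r0.
Qed.

(** Time [0] is separate: the sub-Markovian property is about positive times, and
    [S 0] is the identity. *)
Lemma semigroup_mean01 r : 0 <= r -> forall u : Lp,
  {ae m, forall x, 0 <= u x <= 1} -> 0 <= mean G (S r u) <= 1.
Proof.
rewrite le_eqVlt => /predU1P[<- u u01|r0 u u01].
  by rewrite (c0_id S_c0); exact: mean01.
by apply: mean01 => //; exact: S_markov.
Qed.

(** The measurable [k], almost everywhere the mean of [S (T - s) (f (u s))], is
    obtained from the integral formula at time [T]. It serves at every earlier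
    time [t] because [(T - t) + (t - s)] does not depend on [t]. *)
Lemma no_mild_solution_until (I : set R) (u : R -> Lp) :
  mild_solution S f a I u -> ~ (forall t : R, 0 <= t -> t <= T -> I t).
Proof.
move=> [u_ge0 u_dom _ u_eq] IT.
have [A_gt0 FA] := osgood_le_of_gt_inv f_convex f_continuous f0 f_gt0 f_integral T_gt0 G_mean.
set A := mean G (S T a) in A_gt0 FA.
have bmean := @bounded_form_mean _ _ _ m p p1 G mG G_fin.
have [vT [sn snT _] _] := u_eq T (IT T (ltW T_gt0) (lexx T)).
have [|k mk kE] := bochner_form_ae _ bmean snT; first exact: measurable_itv.
have kI t : 0 < t -> t <= T -> mu.-integrable `]0, t] (EFin \o k) /\
    A + \int[mu]_(r in `]0, t]) k r = mean G (S (T - t) (u t)).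
  move=> t0 tT; have [v hv uE] := u_eq t (IT t (ltW t0) tT).
  have Tt0 : 0 <= T - t by rewrite subr_ge0.
  have bt := semigroup_mean_bounded_form Tt0.
  have tsub : `]0, t]%classic `<=` `]0, T]%classic.
    by move=> x /=; rewrite !in_itv/= => /andP[->] /le_trans ->.
  have [|||ik kv] := bochner_form_integral _ bt hv (k := k).
  - exact: measurable_itv.
  - exact: measurable_funS mk.
  - apply: filterS kE => x kE xt; rewrite kE; last exact: tsub.
    move: xt; rewrite /= in_itv/= => /andP[x0 xt].
    rewrite -(c0_add S_c0)// ?subr_ge0//; congr (mean G (S _ _)); ring.
  - split=> //; rewrite kv uE; have /= -> := bformD bt (S t a) v.
    by rewrite -(c0_add S_c0) ?(ltW t0)// subrK.
pose y t := A + \int[mu]_(r in `]0, t]) k r.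
have yE t : 0 < t -> t <= T -> y t = mean G (S (T - t) (u t)) by move=> t0 /(kI _ t0)[].
have y0 : y 0 = A.
  by rewrite /y set_itv_ge ?bnd_simp ?ltxx// Rintegral_set0 addr0.
have y_ge0 t : 0 <= t -> t <= T -> 0 <= y t.
  rewrite le_eqVlt => /predU1P[<- _|t0 tT]; first by rewrite y0 ltW.
  have Tt0 : 0 <= T - t by rewrite subr_ge0.
  rewrite yE//; apply: (sub_markov_functional_ge0 (semigroup_mean_bounded_form Tt0)).
    exact: semigroup_mean01.
  by apply: u_ge0; apply: IT => //; exact: ltW.
have fk : {ae mu, forall r : R, `]0, T]%classic r -> f (y r) <= k r}.
  apply: filterS kE => r kE rT; rewrite kE//.
  move: rT; rewrite /= in_itv/= => /andP[r0 rT].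
  have Tr0 : 0 <= T - r by rewrite subr_ge0.
  have Ir := IT r (ltW r0) rT.
  rewrite yE//; apply: (sub_markov_functional_jensen (semigroup_mean_bounded_form Tr0)) => //.
  - exact: semigroup_mean01.
  - exact: u_ge0.
  - by apply: comp_opE; apply: u_dom => //; rewrite gt_eqF.
have f_nd := convex_nondecreasing f_convex f0 f_gt0.
have y_incr := volterra_increment f_ge0 (fun s t => @f_nd s t) (kI T T_gt0 (lexx T)).1
  (fun t _ _ => erefl (y t)) y_ge0 fk.
have := osgood_lifespan f_convex f_continuous f0 f_gt0 f_integral T_gt0 _ y_incr.
by rewrite y0 => /(_ A_gt0); rewrite ltNge FA.
Qed.

End blow_up.

Theorem theorem4p1 (R : realType) (d : measure_display) (X : measurableType d)
    (m : {sigma_finite_measure set X -> \bar R})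
    (p : R) (p1 : (1 <= p%:E)%E)
    (S : R -> {linear LspaceType m p1 -> LspaceType m p1})
    (S_c0 : c0_semigroup S) (S_markov : sub_markovian S)
    (DL : set (LspaceType m p1)) (L : LspaceType m p1 -> LspaceType m p1)
    (L_gen : infinitesimal_generator S DL L)
    (f : R -> R)
    (f_ge0 : forall s : R, 0 <= s -> 0 <= f s)
    (f_convex : convex_function (`[0, +oo[%classic : set R) f)
    (f_continuous : {within `[0, +oo[, continuous f})
    (f0 : f 0 = 0) (f_gt0 : forall s : R, 0 < s -> 0 < f s)
    (f_integral : (\int[lebesgue_measure]_(s in `[1%R, +oo[) ((f s)^-1)%:E < +oo)%E)
    (a : LspaceType m p1) (a_ge0 : ae_nonneg a)
    (T : R) (T_gt0 : 0 < T)
    (G : set X) (G_measurable : measurable G)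
    (G_gt0 : (0 < m G)%E) (G_fin : (m G < +oo)%E)
    (G_mean : (fine (m G))^-1 * \int[m]_(x in G) S T a x > osgood_inv f T) :
  (~ exists u : R -> LspaceType m p1, global_mild_solution S f a u) /\
  (forall (I : set R) (u : R -> LspaceType m p1),
     is_interval I -> I `<=` `[0, +oo[ -> I 0 ->
     mild_solution S f a I u ->
     (ereal_sup (EFin @` I) <= T%:E)%E).
Proof.
have blow_up := no_mild_solution_until S_c0 S_markov f_ge0 f_convex
  f_continuous f0 f_gt0 f_integral T_gt0 G_measurable G_gt0 G_fin G_mean.
split=> [[u /blow_up]|I u itvI _ I0 /blow_up IT].
  by apply=> t t0 _; rewrite /= in_itv/= t0.
apply: ge_ereal_sup => _ [t It <-]; rewrite lee_fin leNgt; apply/negP => Tt.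
apply: IT => s s0 sT; apply: (itvI 0 t) => //.
by rewrite s0 (le_trans sT)// ltW.
Qed.
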